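(* (Lifting Lemma) Work in the category $\mathbf{Spaces}$. Let $(Y,<)$ be an $R$-structure. Then there exists a surjection $\phi\colon Y\rightarrow \mathsf{RIdl}(Y,<)$ such that, for any space $X$ with specialisation order $\sqsubseteq$, composition with $\phi$ induces an equivalence between: \begin{itemize} \item maps $\overline{f}\colon \mathsf{RIdl}(Y,<)\rightarrow X$; and \item maps $f\colon Y\rightarrow X$ satisfying the following two conditions for all $q,q'\in Y$: (i) (Monotonicity) $q'<q \implies f(q')\sqsubseteq f(q)$; (ii) (Continuity) $f(q)=\bigsqcup^{\uparrow}_{q'<q}f(q')$ (a directed join). \end{itemize}
   Context: $\mathbf{Spaces}$ is the opposite of the category of frames and frame homomorphisms (a frame is a complete lattice in which finite meets distribute over arbitrary joins; homomorphisms preserve arbitrary joins and finite meets). Its objects are called (localic) spaces and its morphisms maps; $\Omega X$ denotes the frame of $X$. A space is presented by a propositional geometric theory, whose models are its points. A set $Y$ is regarded as a discrete space (frame = powerset), so a map $f\colon Y\to X$ assigns to each $q\in Y$ a point $f(q)$ of $X$. The specialisation order on points of $X$ is: $x\sqsubseteq y$ iff every open containing $x$ contains $y$; directed joins of points with respect to $\sqsubseteq$ always exist, and are denoted $\bigsqcup^{\uparrow}$. A map $\phi\colon Y\to Z$ in $\mathbf{Spaces}$ is a surjection if it is an epimorphism in $\mathbf{Spaces}$, equivalently if the inverse image function $\Omega\phi\colon \Omega Z\to\Omega Y$ is one-to-one. Let $Y$ be a set with a dense transitive relation $<$ (dense: $x<z$ implies $x<y<z$ for some $y$; $<$ is not required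 to be strict, i.e. irreflexive). An ideal of $(Y,<)$ is a subset $I\subseteq Y$ that is downward closed ($y'<y\in I$ implies $y'\in I$) and contains an upper bound with respect to $<$ of each of its finite subsets (for every finite $S\subseteq I$ there is $y\in I$ with $s<y$ for all $s\in S$; in particular $I$ is inhabited). $(Y,<)$ is an $R$-structure if $I_q:=\{q'\in Y\mid q'<q\}$ is an ideal for every $q\in Y$. The rounded ideal completion $\mathsf{RIdl}(Y,<)$ is the space whose points are the ideals of $(Y,<)$: it is presented by the propositional geometric theory with one proposition ''$q\in I$'' for each $q\in Y$ and axioms saying that $I$ is an ideal. Its specialisation order is inclusion of ideals. *)

(* Defs.v *)
From Stdlib Require List.
From HB Require Import structures.
From mathcomp Require Import all_boot all_order.
From mathcomp Require Import boolp classical_sets functions cardinality.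

Set Implicit Arguments.
Unset Strict Implicit.
Unset Printing Implicit Defensive.

Import Order.TTheory.
Export SetOrder.Exports.
Local Open Scope classical_set_scope.

HB.mixin Record TBLattice_isFrame (d : Order.disp_t) (T : Type)
    of Order.TBLattice d T := {
  fsup : set T -> T;
  fsup_ub : forall A : set T, ubound A (fsup A);
  fsup_le : forall (A : set T) (y : T), ubound A y -> (fsup A <= y)%O;
  meet_fsup : forall (x : T) (A : set T),
    Order.meet x (fsup A) = fsup [set Order.meet x y | y in A]
}.

#[short(type="frameType")]
HB.structure Definition Frame (d : Order.disp_t) :=
  { T of TBLattice_isFrame d T & Order.TBLattice d T }.

Record space := Space { space_disp : Order.disp_t; Omega : frameType space_disp }.

(* A map X -> Y is a frame homomorphism in the opposite direction. Preservation
   of joins covers the bottom element (the join of set0) and binary joins. *)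
Record space_map (X Y : space) := Map {
  invim : Omega Y -> Omega X;
  invimT : invim \top%O = \top%O;
  invimI : forall U V, invim (Order.meet U V) = Order.meet (invim U) (invim V);
  invim_sup : forall A : set (Omega Y), invim (fsup A) = fsup (invim @` A)
}.

Lemma map_ext (X Y : space) (f g : space_map X Y) : invim f =1 invim g -> f = g.
Proof.
case: f => f fT fI fS; case: g => g gT gI gS /= /funext fg.
by case: _ / fg in gT gI gS *; congr Map; apply: Prop_irrelevance.
Qed.

Section Comp.
Variables (X Y Z : space) (g : space_map Y Z) (f : space_map X Y).

Let h : Omega Z -> Omega X := invim f \o invim g.

Lemma comp_subproofT : h \top%O = \top%O.
Proof. by rewrite /h /= !invimT. Qed.

Lemma comp_subproofI U V : h (Order.meet U V) = Order.meet (h U) (h V).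
Proof. by rewrite /h /= !invimI. Qed.

Lemma comp_subproof_sup (A : set (Omega Z)) : h (fsup A) = fsup (h @` A).
Proof. by rewrite /h /= !invim_sup image_comp. Qed.

Definition comp_map : space_map X Z :=
  Map comp_subproofT comp_subproofI comp_subproof_sup.
End Comp.

Definition surjection (Y Z : space) (phi : space_map Y Z) : Prop :=
  forall (W : space) (g h : space_map Z W), comp_map g phi = comp_map h phi -> g = h.

Section Powerset.
Variable Y : Type.

Let bigcups (A : set (set Y)) : set Y := \bigcup_(B in A) B.

Lemma powerset_sup_ub (A : set (set Y)) : ubound A (bigcups A).
Proof. by move=> B AB; rewrite subsetEset; exact: bigcup_sup. Qed.

Lemma powerset_sup_le (A : set (set Y)) (B : set Y) :
  ubound A B -> (bigcups A <= B)%O.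
Proof.
by move=> ubB; rewrite subsetEset; apply: bigcup_sub => C /ubB; rewrite subsetEset.
Qed.

Lemma powerset_meet_sup (B : set Y) (A : set (set Y)) :
  Order.meet B (bigcups A) = bigcups [set Order.meet B C | C in A].
Proof.
rewrite /bigcups bigcup_image meetEset setI_bigcupr.
by apply: eq_bigcupr => C _; rewrite meetEset.
Qed.

HB.instance Definition _ := TBLattice_isFrame.Build set_display (set Y)
  powerset_sup_ub powerset_sup_le powerset_meet_sup.
End Powerset.

Definition discrete (Y : Type) : space := Space (set Y : frameType _).

Definition pt (X : space) : Type := space_map (discrete unit) X.

(* A point of X is a frame homomorphism Omega X -> set unit, and set unit is
   the frame of truth values, so evaluating at tt gives membership. *)
Definition in_open (X : space) (x : pt X) (U : Omega X) : Prop :=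
  invim x U tt.

Section Element.
Variables (Y : Type) (q : Y).

Let h : Omega (discrete Y) -> Omega (discrete unit) := fun A => [set _ | A q].

Lemma element_subproofT : h \top%O = \top%O.
Proof. by []. Qed.

Lemma element_subproofI U V : h (Order.meet U V) = Order.meet (h U) (h V).
Proof. by []. Qed.

Lemma element_subproof_sup (A : set (Omega (discrete Y))) :
  h (fsup A) = fsup (h @` A).
Proof.
apply/seteqP; split => [u [B AB Bq]|u [_ [B AB <-] Bq]].
  by exists (h B) => //; exists B.
by exists B.
Qed.

Definition element : pt (discrete Y) :=
  Map element_subproofT element_subproofI element_subproof_sup.
End Element.

Definition value (Y : Type) (X : space) (f : space_map (discrete Y) X) (q : Y) : pt X :=
  comp_map f (element q).

Definition spec_le (X : space) (x y : pt X) : Prop :=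
  forall U : Omega X, in_open x U -> in_open y U.

Definition directed (X : space) (D : set (pt X)) : Prop :=
  D !=set0 /\
  forall x y, D x -> D y -> exists z, [/\ D z, spec_le x z & spec_le y z].

Definition is_directed_join (X : space) (D : set (pt X)) (x : pt X) : Prop :=
  [/\ directed D,
      forall y, D y -> spec_le y x &
      forall z, (forall y, D y -> spec_le y z) -> spec_le x z].

(* [axiom l M] is the sequent "conjunction of l |- disjunction over m in M of
   the conjunctions of m"; sequences stand for finite sets of propositions.
   Every propositional geometric theory can be put in this form, since every
   geometric formula is equivalent to a disjunction of finite conjunctions. *)
Record theory := Theory {
  proposition : Type;
  axiom : seq proposition -> set (seq proposition) -> Prop
}.

Section Model.
Variables (T : theory) (d : Order.disp_t) (L : frameType d).
Variable v : proposition T -> L.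

Definition conjunction (l : seq (proposition T)) : L := (\meet_(x <- l) v x)%O.

Definition is_model : Prop :=
  forall l M, axiom l M -> (conjunction l <= fsup (conjunction @` M))%O.
End Model.

(* The frame presented by T: a sequence l stands for the conjunction of its
   entries, and an open is a set of such conjunctions closed under entailment
   according to T. See [classifying_universal] below. *)
Definition saturated (T : theory) (U : set (seq (proposition T))) : Prop :=
  (forall l m, List.incl m l -> U m -> U l) /\
  (forall k l M, axiom l M -> (forall m, M m -> U (k ++ m)) -> U (k ++ l)).

Fact open_display : Order.disp_t. Proof. by []. Qed.

Definition open_of (T : theory) : Type :=
  {U : set (seq (proposition T)) | `[< saturated U >]}.

Section Classifying.
Variable T : theory.
Local Notation S := (seq (proposition T)).

HB.instance Definition _ := [isSub for (@sval _ _ : open_of T -> set S)].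
HB.instance Definition _ := [Choice of open_of T by <:].
HB.instance Definition _ := [SubChoice_isSubPOrder of open_of T by <: with open_display].

Definition mk_open (U : set S) (satU : saturated U) : open_of T :=
  exist _ U (asboolT satU).

Lemma open_sat (U : open_of T) : saturated (val U).
Proof. by case: U => U /= /asboolP. Qed.

Lemma open_leP (U V : open_of T) : reflect (val U `<=` val V) (U <= V)%O.
Proof. by rewrite leEsub -subsetEset; exact: idP. Qed.

Lemma saturated_bigcap (F : set (set S)) :
  (forall U, F U -> saturated U) -> saturated (\bigcap_(U in F) U).
Proof.
move=> satF; split => [l m lm Um U FU|k l M ax UM U FU].
  by have [down _] := satF U FU; apply: down lm (Um U FU).
have [_ stab] := satF U FU; apply: stab ax _ => m Mm; exact: UM.
Qed.

Definition saturation (A : set S) : set S :=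
  \bigcap_(U in [set U | saturated U /\ A `<=` U]) U.

Lemma saturation_sat A : saturated (saturation A).
Proof. by apply: saturated_bigcap => U []. Qed.

Lemma sub_saturation A : A `<=` saturation A.
Proof. by move=> l Al U [_]; apply. Qed.

Lemma saturation_sub A U : saturated U -> A `<=` U -> saturation A `<=` U.
Proof. by move=> satU AU l; apply. Qed.

Lemma saturatedI (U V : set S) : saturated U -> saturated V -> saturated (U `&` V).
Proof.
move=> [dU sU] [dV sV]; split => [l m lm [Um Vm]|k l M ax UV].
  by split; [apply: dU Um|apply: dV Vm].
by split; [apply: sU ax _|apply: sV ax _] => m /UV[].
Qed.

Lemma saturated_imply (P U : set S) :
  saturated U -> saturated [set k | forall l, P l -> U (k ++ l)].
Proof.
move=> [dU sU]; split => [l m lm Wm n Pn|k l M ax WM n Pn].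
  by apply: dU (Wm n Pn); apply: List.incl_app_app => // x.
have swap (a b c : S) : List.incl ((a ++ b) ++ c) ((a ++ c) ++ b).
  by move=> x; rewrite !List.in_app_iff; tauto.
apply: (dU _ _ (swap k n l)); apply: sU ax _ => m Mm.
by apply: (dU _ _ (swap k m n)); exact: WM.
Qed.

Lemma saturatedT : saturated [set: S].
Proof. by []. Qed.

Definition open_gen (A : set S) : open_of T := mk_open (saturation_sat A).

Definition open_sup (A : set (open_of T)) : open_of T :=
  open_gen (\bigcup_(U in A) val U).

Definition open_meet (U V : open_of T) : open_of T :=
  mk_open (saturatedI (open_sat U) (open_sat V)).

Definition open_join (U V : open_of T) : open_of T := open_sup [set U; V].

Lemma open_sup_ub (A : set (open_of T)) : ubound A (open_sup A).
Proof.
by move=> U AU; apply/open_leP => l Ul; apply: sub_saturation; exists U.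
Qed.

Lemma open_sup_le (A : set (open_of T)) (V : open_of T) :
  ubound A V -> (open_sup A <= V)%O.
Proof.
move=> ubV; apply/open_leP; apply: saturation_sub; first exact: open_sat.
by apply: bigcup_sub => U /ubV /open_leP.
Qed.

Lemma open_lexI (U V W : open_of T) :
  (U <= open_meet V W)%O = (U <= V)%O && (U <= W)%O.
Proof.
apply/open_leP/andP => [UVW|[/open_leP UV /open_leP UW] l Ul].
  by split; apply/open_leP => l /UVW[].
by split; [exact: UV|exact: UW].
Qed.

Lemma open_leUx (U V W : open_of T) :
  (open_join U V <= W)%O = (U <= W)%O && (V <= W)%O.
Proof.
apply/idP/andP => [UVW|[UW VW]].
  by split; apply: le_trans UVW; apply: open_sup_ub; [left|right].
by apply: open_sup_le => _ [] ->.
Qed.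

HB.instance Definition _ :=
  Order.POrder_isMeetSemilattice.Build open_display (open_of T) open_lexI.
HB.instance Definition _ :=
  Order.POrder_isJoinSemilattice.Build open_display (open_of T) open_leUx.

Lemma open_le0x (U : open_of T) : (open_gen set0 <= U)%O.
Proof. by apply/open_leP; apply: saturation_sub (open_sat U) _. Qed.

Lemma open_lex1 (U : open_of T) : (U <= mk_open saturatedT)%O.
Proof. exact/open_leP. Qed.

HB.instance Definition _ :=
  Order.hasBottom.Build open_display (open_of T) open_le0x.
HB.instance Definition _ :=
  Order.hasTop.Build open_display (open_of T) open_lex1.

Lemma open_meet_sup (U : open_of T) (A : set (open_of T)) :
  Order.meet U (open_sup A) = open_sup [set Order.meet U V | V in A].
Proof.
apply/eqP; rewrite eq_le; apply/andP; split; last first.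
  apply: open_sup_le => _ [V AV <-].
  by rewrite lexI leIl /= (le_trans (leIr _ _))// open_sup_ub.
have [dU _] := open_sat U.
set R := open_sup [set _ | _ in _]; have [dR _] := open_sat R.
apply/open_leP => l [Ul Al].
have : [set k | forall l, val U l -> val R (k ++ l)] l.
  apply: Al; split=> [|m [V AV Vm] n Un].
    exact: (saturated_imply (val U) (open_sat R)).
  have [dV _] := open_sat V.
  have /open_leP : (Order.meet U V <= R)%O by apply: open_sup_ub; exists V.
  apply.
  split; first by apply: dU Un => x; rewrite List.in_app_iff; right.
  by apply: dV Vm => x; rewrite List.in_app_iff; left.
move=> /(_ l Ul); apply: dR => x; rewrite List.in_app_iff; tauto.
Qed.

HB.instance Definition _ := TBLattice_isFrame.Build open_display (open_of T)
  open_sup_ub open_sup_le open_meet_sup.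

Definition classifying : space := Space (open_of T : frameType _).

Definition generic (x : proposition T) : Omega classifying := open_gen [set [:: x]].

End Classifying.

Section Universal.
Variable T : theory.
Local Notation S := (seq (proposition T)).

Lemma conjunction_cat (d : Order.disp_t) (L : frameType d) (v : proposition T -> L)
    (k l : S) :
  conjunction v (k ++ l) = Order.meet (conjunction v k) (conjunction v l).
Proof. by rewrite /conjunction big_cat. Qed.

Lemma open_weaken (U : open_of T) (k l : S) : List.incl k l -> val U k -> val U l.
Proof. by have [down _] := open_sat U; exact: down. Qed.

Lemma open_gen_in (A : set S) (l : S) : A l -> val (open_gen A) l.
Proof. by move=> Al; apply: (@sub_saturation T A). Qed.

Lemma open_gen1 (l : S) : val (open_gen [set l]) l.
Proof. exact: open_gen_in. Qed.

Arguments open_weaken {U k l}.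
Arguments open_gen1 : clear implicits.

Lemma open_gen_le (U : open_of T) (A : set S) : A `<=` val U -> (open_gen A <= U)%O.
Proof.
by move=> AU; apply/open_leP; apply: saturation_sub; first exact: open_sat.
Qed.

Lemma open_gen1_le (U : open_of T) (l : S) : val U l -> (open_gen [set l] <= U)%O.
Proof. by move=> Ul; apply: open_gen_le => _ ->. Qed.

Lemma open_gen_cat (k l : S) :
  open_gen [set k ++ l] = Order.meet (open_gen [set k]) (open_gen [set l]).
Proof.
apply/eqP; rewrite eq_le lexI -andbA; apply/and3P; split.
- apply: open_gen1_le; apply: open_weaken (open_gen1 k) => x.
  by rewrite List.in_app_iff; left.
- apply: open_gen1_le; apply: open_weaken (open_gen1 l) => x.
  by rewrite List.in_app_iff; right.
set U := open_gen [set k ++ l].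
have cat_kl (m n : S) : val (open_gen [set k]) n -> val (open_gen [set l]) m ->
    val U (n ++ m).
  move=> nk ml.
  apply: (nk [set a | forall b, val (open_gen [set l]) b -> val U (a ++ b)]) => //.
  split => [|_ -> b bl]; first exact/saturated_imply/open_sat.
  have lU : val U (b ++ k).
    apply: (bl [set a | forall b, [set k] b -> val U (a ++ b)]) => //.
    split => [|_ -> _ ->]; first exact/saturated_imply/open_sat.
    by apply: open_weaken (open_gen1 _) => x; rewrite !List.in_app_iff; tauto.
  by apply: open_weaken lU => x; rewrite !List.in_app_iff; tauto.
apply/open_leP => n [nk nl]; apply: open_weaken (cat_kl n n nk nl) => x.
by rewrite List.in_app_iff; tauto.
Qed.

Lemma conjunction_generic (l : S) : conjunction (@generic T) l = open_gen [set l].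
Proof.
elim: l => [|x l IH].
  rewrite /conjunction big_nil; apply/eqP; rewrite eq_le lex1 andbT.
  by apply/open_leP => l _; apply: open_weaken (open_gen1 [::]) => x [].
by rewrite -cat1s conjunction_cat IH open_gen_cat /conjunction big_seq1.
Qed.

Lemma open_genE (A : set S) : open_gen A = fsup [set open_gen [set l] | l in A].
Proof.
apply/eqP; rewrite eq_le; apply/andP; split.
  apply: open_gen_le => l Al.
  have /open_leP : (open_gen [set l] <= fsup [set open_gen [set l] | l in A])%O.
    by apply: fsup_ub; exists l.
  by apply; exact: open_gen1.
by apply: fsup_le => _ [l Al <-]; apply: open_gen1_le; apply: open_gen_in.
Qed.

Lemma generic_model : is_model (@generic T).
Proof.
move=> l M ax; rewrite conjunction_generic; apply: open_gen1_le.
set R := fsup _; have [_ stab] := open_sat R.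
apply: (stab [::] l M ax) => m Mm /=.
have /open_leP : (open_gen [set m] <= R)%O.
  by apply: fsup_ub; exists m => //; exact: conjunction_generic.
by apply; exact: open_gen1.
Qed.

Lemma classifying_universal (X : space) (v : proposition T -> Omega X) :
  is_model v ->
  exists! f : space_map X (classifying T), forall x, invim f (generic x) = v x.
Proof.
move=> mod_v.
pose h (U : Omega (classifying T)) : Omega X := fsup (conjunction v @` val U).
have sat_le (y : Omega X) : saturated [set l : S | (conjunction v l <= y)%O].
  split => [l m lm /=|k l M ax kM /=].
    apply: le_trans; rewrite {}/conjunction.
    elim: m lm => [|x m IH] lm; first by rewrite big_nil lex1.
    rewrite big_cons lexI IH ?andbT; last by move=> z zm; apply: lm; right.
    have : List.In x l by apply: lm; left.
    elim: l {lm IH} => //= z l IH [->|xl]; rewrite big_cons; first exact: leIl.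
    by rewrite (le_trans (leIr _ _))// IH.
  rewrite conjunction_cat (@le_trans _ _ (Order.meet (conjunction v k)
    (fsup (conjunction v @` M))))// ?leI2 ?mod_v// meet_fsup.
  by apply: fsup_le => _ [_ [m Mm <-] <-]; rewrite -conjunction_cat; exact: kM.
have hgen (A : set S) : h (open_gen A) = fsup (conjunction v @` A).
  apply/eqP; rewrite eq_le; apply/andP; split; apply: fsup_le => _ [l Al <-].
    apply: (Al [set m | (conjunction v m <= _)%O]); split => // m Am.
    by apply: fsup_ub; exists m.
  by apply: fsup_ub; exists l => //; exact: open_gen_in.
have hT : h \top%O = \top%O.
  apply/eqP; rewrite eq_le lex1 /=; apply: fsup_ub.
  by exists [::] => //; rewrite /conjunction big_nil.
have hI U V : h (Order.meet U V) = Order.meet (h U) (h V).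
  apply/eqP; rewrite eq_le; apply/andP; split.
    apply: fsup_le => _ [l [Ul Vl] <-].
    by rewrite lexI; apply/andP; split; apply: fsup_ub; exists l.
  rewrite /h meet_fsup; apply: fsup_le => _ [_ [l Vl <-] <-].
  rewrite meetC meet_fsup; apply: fsup_le => _ [_ [k Uk <-] <-].
  apply: fsup_ub; exists (l ++ k); last exact: conjunction_cat.
  split; first by apply: open_weaken Uk => x; rewrite List.in_app_iff; right.
  by apply: open_weaken Vl => x; rewrite List.in_app_iff; left.
have hS (A : set (Omega (classifying T))) : h (fsup A) = fsup (h @` A).
  apply/eqP; rewrite eq_le; apply/andP; split.
    rewrite hgen; apply: fsup_le => _ [l [U AU Ul] <-].
    apply: (@le_trans _ _ (h U)); first by apply: fsup_ub; exists l.
    by apply: fsup_ub; exists U.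
  apply: fsup_le => _ [U AU <-]; apply: fsup_le => _ [l Ul <-].
  by apply: fsup_ub; exists l => //; apply: open_gen_in; exists U.
exists (Map hT hI hS); split => [x|g gv].
  rewrite /= hgen; apply/eqP; rewrite eq_le; apply/andP; split.
    by apply: fsup_le => _ [_ -> <-]; rewrite /conjunction big_seq1.
  by apply: fsup_ub; exists [:: x] => //; rewrite /conjunction big_seq1.
have gconj l : invim g (open_gen [set l]) = conjunction v l.
  rewrite -conjunction_generic /conjunction.
  elim: l => [|x l IH]; first by rewrite !big_nil invimT.
  by rewrite !big_cons invimI IH gv.
apply: map_ext => U /=.
have -> : U = open_gen (val U).
  apply/eqP; rewrite eq_le; apply/andP; split; last exact: open_gen_le.
  by apply/open_leP => l; exact: open_gen_in.
rewrite hgen [in RHS]open_genE invim_sup image_comp.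
by congr fsup; apply: eq_imagel => l _; rewrite /= gconj.
Qed.

End Universal.

Section RoundedIdeal.
Variables (Y : Type) (lt : Y -> Y -> Prop).

Definition is_ideal (I : set Y) : Prop :=
  (forall y' y, lt y' y -> I y -> I y') /\
  (forall s : set Y, finite_set s -> s `<=` I ->
     exists2 y, I y & forall x, s x -> lt x y).

Definition R_structure : Prop :=
  [/\ forall x y z, lt x y -> lt y z -> lt x z,
      forall x z, lt x z -> exists2 y, lt x y & lt y z &
      forall q, is_ideal [set q' | lt q' q]].

(* The proposition q : Y stands for "q \in I". *)
Inductive ideal_axiom : seq Y -> set (seq Y) -> Prop :=
| ideal_axiom_down y' y : lt y' y -> ideal_axiom [:: y] [set [:: y']]
| ideal_axiom_bound s :
    ideal_axiom s [set [:: y] | y in [set y | forall x, List.In x s -> lt x y]].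

Definition ideal_theory : theory := Theory ideal_axiom.

Definition RIdl : space := classifying ideal_theory.

Definition monotonicity (X : space) (f : space_map (discrete Y) X) : Prop :=
  forall q' q, lt q' q -> spec_le (value f q') (value f q).

Definition continuity (X : space) (f : space_map (discrete Y) X) : Prop :=
  forall q, is_directed_join [set value f q' | q' in [set q' | lt q' q]] (value f q).

End RoundedIdeal.

Lemma seq_finite_set (Y : Type) (s : set Y) :
  finite_set s <-> exists l : seq Y, forall x, s x <-> List.In x l.
Proof.
pose C : choiceType := {classic Y}.
have InP (x : C) (l : seq C) : (x \in l) <-> List.In x l.
  elim: l => //= y l IH; rewrite inE; split.
    by case/orP => [/eqP ->|/IH]; [left|right].
  by case=> [->|/IH ->]; rewrite ?eqxx ?orbT.
split => [/(@finite_seqP C)[l ->]|[l sl]].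
  by exists l => x; exact: InP.
apply/(@finite_seqP C); exists l; apply/seteqP.
by split => x; rewrite /= InP sl.
Qed.

Lemma pt_model (T : theory) (v : proposition T -> Omega (discrete unit)) :
  is_model v <-> forall l M, axiom l M -> (forall x, List.In x l -> v x tt) ->
    exists2 m, M m & forall x, List.In x m -> v x tt.
Proof.
have conjv (l : seq (proposition T)) :
    conjunction v l tt <-> forall x, List.In x l -> v x tt.
  rewrite /conjunction; elim: l => [|x l IH]; first by rewrite big_nil.
  rewrite big_cons meetEset; split => [[vx /IH vl] _ [<-//|/vl]//|vl].
  by split; [apply: vl; left|apply/IH => y yl; apply: vl; right].
split => [mod_v l M ax /conjv vl|mod_v l M ax].
  have := mod_v _ _ ax; rewrite subsetEset => /(_ _ vl)[_ [m Mm <-] /conjv vm].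
  by exists m.
rewrite subsetEset => -[] /conjv vl.
have [m Mm /conjv vm] := mod_v _ _ ax vl.
by exists (conjunction v m) => //; exists m.
Qed.

Lemma pt_generic (T : theory) (x : pt (classifying T)) :
  is_model (fun q => invim x (generic q)).
Proof.
have xconj l : conjunction (fun q => invim x (generic q)) l =
    invim x (conjunction (@generic T) l).
  rewrite /conjunction; elim: l => [|q l IH]; first by rewrite !big_nil invimT.
  by rewrite !big_cons invimI IH.
move=> l M ax; have := generic_model ax; rewrite leEmeet => /eqP xax.
have -> : conjunction (fun q => invim x (generic q)) @` M =
    invim x @` (conjunction (@generic T) @` M).
  by rewrite image_comp; apply: eq_imagel => m _; exact: xconj.
by rewrite xconj -xax invimI -invim_sup leIr.
Qed.

Lemma RIdl_points (Y : Type) (lt : Y -> Y -> Prop) (I : set Y) :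
  is_ideal lt I <->
  exists! x : pt (RIdl lt), forall q, in_open x (@generic (ideal_theory lt) q) <-> I q.
Proof.
split => [[down bound]|[x [xI _]]].
  pose v (q : proposition (ideal_theory lt)) : Omega (discrete unit) := [set _ | I q].
  have /classifying_universal[x [xv xuniq]] : is_model v.
    apply/pt_model => l M; case=> {l M} [y' y y'y /(_ y (or_introl erefl)) Iy|l Il].
      by exists [:: y'] => // _ [<-|//]; exact: down Iy.
    have [] := bound [set y | List.In y l].
    - by apply/seq_finite_set; exists l.
    - by move=> y; exact: Il.
    by move=> y Iy ly; exists [:: y]; [exists y|move=> _ [<-|//]].
  exists x; split => [q|y yI]; first by rewrite /in_open xv.
  apply: xuniq => q; apply/seteqP; rewrite /v.
  by split => -[] /=; move/(yI q).
have /pt_model mod_x := pt_generic x; split => [y' y y'y /xI Iy|s fin_s sI].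
  have [|_ -> /(_ y' (or_introl erefl)) /xI//] := mod_x _ _ (ideal_axiom_down y'y).
  by move=> _ [<-|//].
have [l sl] := (seq_finite_set s).1 fin_s.
have [|_ [y ly <-] /(_ y (or_introl erefl)) /xI Iy] := mod_x _ _ (ideal_axiom_bound lt l).
  by move=> y /sl /sI /xI.
by exists y => // z /sl; exact: ly.
Qed.

(* Main.v *)
(** The points of Y name the principal ideals I_q, and the inverse image of
    phi sends an open U to the set of q with I_q in U. The ideal axioms make every
    open U of RIdl the join of the basic opens "y \in I" with y in phi^*(U), so
    phi^* is injective. Its image consists of the sets A that are upper closed and
    rounded (each q in A has some q' < q in A). Monotonicity and continuity of f
    say exactly that f^*(V) is such a set for every V, so f^* factors through phi^*,
    and the factor is a frame homomorphism because phi^* is injective. *)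
Require Import Defs.
From mathcomp Require Import all_boot all_order.
From mathcomp Require Import boolp classical_sets functions cardinality.

Set Implicit Arguments.
Unset Strict Implicit.
Unset Printing Implicit Defensive.

Local Open Scope classical_set_scope.

(** * Inverse images along maps into a classifying space *)

Lemma in_conjunction (T : theory) (Z : Type) (v : proposition T -> set Z)
    (l : seq (proposition T)) (z : Z) :
  conjunction v l z <-> forall x, List.In x l -> v x z.
Proof.
rewrite /conjunction; elim: l => [|x l IH]; first by rewrite big_nil.
rewrite big_cons meetEset; split=> [[vx /IH vl] _ [<-//|/vl]//|vl].
by split; [apply: vl; left|apply/IH => y yl; apply: vl; right].
Qed.

Lemma invim_conjunction (T : theory) (X : space) (g : space_map X (classifying T))
    (l : seq (proposition T)) :
  invim g (conjunction (@generic T) l) = conjunction (fun x => invim g (generic x)) l.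
Proof.
rewrite /conjunction; elim: l => [|x l IH]; first by rewrite !big_nil invimT.
by rewrite !big_cons invimI IH.
Qed.

Lemma open_genK (T : theory) (U : open_of T) : open_gen (val U) = U.
Proof.
apply/eqP; rewrite Order.POrderTheory.eq_le open_gen_le //=.
by apply/open_leP => l; exact: open_gen_in.
Qed.

(** Every open is the join of the basic opens of its members, and these are finite meets of generic
    opens, so a map into a classifying space is computed from its values on the generators. *)
Lemma invim_classifying (T : theory) (X : space) (g : space_map X (classifying T))
    (U : open_of T) :
  invim g U = fsup (conjunction (fun x => invim g (generic x)) @` val U).
Proof.
rewrite -[in LHS](open_genK U) open_genE invim_sup image_comp.
by congr fsup; apply: eq_imagel => l _ /=; rewrite -conjunction_generic invim_conjunction.
Qed.

(** * Epimorphisms and factorisation *)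

Lemma invim_inj_surjection (Y Z : space) (phi : space_map Y Z) :
  injective (invim phi) -> surjection phi.
Proof.
move=> phi_inj W g h gh; apply: map_ext => U; apply: phi_inj.
by rewrite -[LHS]/(invim (comp_map g phi) U) gh.
Qed.

Lemma factor_through_surjection (X Y Z : space) (phi : space_map Y Z)
    (f : space_map Y X) :
  injective (invim phi) -> (forall V, exists U, invim phi U = invim f V) ->
  exists g : space_map Z X, comp_map g phi = f.
Proof.
(* Preimages under [invim phi] are chosen arbitrarily; injectivity makes them unique, so each
   homomorphism law for [h] can be checked after applying [invim phi], where it is a law of
   [invim f]. *)
move=> phi_inj /choice[h hE].
have hT : h \top%O = \top%O by apply: phi_inj; rewrite hE !invimT.
have hI U V : h (Order.meet U V) = Order.meet (h U) (h V).
  by apply: phi_inj; rewrite hE !invimI !hE.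
have hS (A : set (Omega X)) : h (fsup A) = fsup (h @` A).
  apply: phi_inj; rewrite hE !invim_sup image_comp.
  by congr fsup; apply: eq_imagel => V _; rewrite /= hE.
by exists (Map hT hI hS); exact: map_ext.
Qed.

(** * Directed joins of points *)

Section DirectedJoin.
Variables (X : space) (D : set (pt X)).

Let in_some (U : Omega X) : set unit := [set _ | exists2 x, D x & in_open x U].

(** The truth value [in_some U] is the inverse image of the join point. Inhabitedness of [D] gives
    the top element, upper bounds of pairs give binary meets, and joins are preserved for any
    [D]. *)
Lemma directed_join_exists : directed D ->
  exists z : pt X, forall U, in_open z U <-> exists2 x, D x & in_open x U.
Proof.
move=> [[x0 Dx0] dirD].
have hT : in_some \top%O = \top%O.
  by apply/seteqP; split=> // u _; exists x0; rewrite // /in_open invimT.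
have hI U V : in_some (Order.meet U V) = Order.meet (in_some U) (in_some V).
  apply/seteqP; split=> [u [x Dx]|u [[x Dx xU] [y Dy yV]]].
    by rewrite /in_open invimI => -[xU xV]; split; exists x.
  have [z [Dz xz yz]] := dirD _ _ Dx Dy; exists z => //.
  by rewrite /in_open invimI; split; [exact: xz|exact: yz].
have hS (A : set (Omega X)) : in_some (fsup A) = fsup (in_some @` A).
  apply/seteqP; split=> [u [x Dx]|u [_ [U AU <-] [x Dx xU]]].
    rewrite /in_open invim_sup => -[_ [U AU <-] xU].
    by exists (in_some U); [exists U|exists x].
  exists x => //; rewrite /in_open invim_sup.
  by exists (invim x U) => //; exists U.
by exists (Map (X := discrete unit) hT hI hS).
Qed.

(** A join is only known to be least for [spec_le]. Comparing it with the concrete upper bound [z]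
    built above shows that an open containing the join already contains a member of [D]. *)
Lemma directed_join_open (x : pt X) (U : Omega X) :
  is_directed_join D x -> in_open x U -> exists2 y, D y & in_open y U.
Proof.
move=> [/directed_join_exists[z zE] _ least] xU.
apply/zE; apply: least xU => y Dy V yV; apply/zE; by exists y.
Qed.

End DirectedJoin.

(** * The map of principal ideals and its inverse image *)

Section PrincipalIdeals.
Variables (Y : Type) (lt : Y -> Y -> Prop) (hY : R_structure lt).
Local Notation T := (ideal_theory lt).

(** Equivalently, the principal ideal of [y] contains all entries of [l], that is, it lies in the
    basic open of [l]. *)
Definition upper_bound (l : seq Y) (y : Y) : Prop := forall x, List.In x l -> lt x y.

Lemma upper_bound1 (x y : Y) : upper_bound [:: x] y <-> lt x y.
Proof. by split=> [|xy _ [<-//|//]]; apply; left. Qed.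

Lemma upper_bound_cat (k l : seq Y) (y : Y) :
  upper_bound (k ++ l) y <-> upper_bound k y /\ upper_bound l y.
Proof.
split=> [b|[bk bl] x]; last by rewrite List.in_app_iff => -[/bk|/bl].
by split=> x xl; apply: b; rewrite List.in_app_iff; [left|right].
Qed.

Lemma upper_bound_trans (l : seq Y) (y z : Y) :
  upper_bound l y -> lt y z -> upper_bound l z.
Proof. by case: hY => tr _ _ ly yz x /ly xy; exact: tr yz. Qed.

(** The entries of [l] form a finite subset of the ideal below [z], which therefore contains a bound
    of them. This one fact later yields roundedness, inhabitedness and directedness. *)
Lemma upper_bound_interpolate (l : seq Y) (z : Y) :
  upper_bound l z -> exists2 y, upper_bound l y & lt y z.
Proof.
case: hY => _ _ /(_ z)[_ bound] lz.
have [|x /lz//|y yz ly] := bound [set x | List.In x l].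
  by apply/seq_finite_set; exists l.
by exists y.
Qed.

Lemma principal_ideal_model :
  is_model (fun q : proposition T => [set q' | lt q q'] : Omega (discrete Y)).
Proof.
move=> l M ax; rewrite subsetEset => z /in_conjunction lz.
case: ax lz => {l M} [y' y y'y yz|l /upper_bound_interpolate[y ly yz]].
  exists (conjunction (fun q : proposition T => [set q' | lt q q']) [:: y']).
    by exists [:: y'].
  apply/in_conjunction/upper_bound1.
  by case: hY => tr _ _; apply: tr y'y _; apply/(upper_bound1 y z).
exists (conjunction (fun q : proposition T => [set q' | lt q q']) [:: y]).
  by exists [:: y] => //; exists y.
exact/in_conjunction/upper_bound1.
Qed.

Lemma principal_ideals_exist :
  exists phi : space_map (discrete Y) (RIdl lt),
    forall U q, invim phi U q <-> exists2 l, val U l & upper_bound l q.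
Proof.
have [phi [phiE _]] := classifying_universal principal_ideal_model.
exists phi => U q; rewrite invim_classifying.
rewrite (funext phiE : (fun x => invim phi (generic x)) = _).
split=> [[_ [l Ul <-]]|[l Ul lq]]; first by move/in_conjunction; exists l.
exists (conjunction (fun q : proposition T => [set q' | lt q q']) l).
  by exists l.
exact/in_conjunction.
Qed.

Definition principal_ideals : space_map (discrete Y) (RIdl lt) :=
  sval (cid principal_ideals_exist).

Lemma in_invim_principal (U : Omega (RIdl lt)) (q : Y) :
  invim principal_ideals U q <-> exists2 l, val U l & upper_bound l q.
Proof. by rewrite /principal_ideals; case: cid. Qed.

Lemma invim_principal_up (U : Omega (RIdl lt)) (q' q : Y) :
  lt q' q -> invim principal_ideals U q' -> invim principal_ideals U q.
Proof.
move=> q'q /in_invim_principal[l Ul lq']; apply/in_invim_principal.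
by exists l => //; exact: upper_bound_trans q'q.
Qed.

Lemma invim_principal_rounded (U : Omega (RIdl lt)) (q : Y) :
  invim principal_ideals U q -> exists2 q', lt q' q & invim principal_ideals U q'.
Proof.
move=> /in_invim_principal[l Ul /upper_bound_interpolate[q' lq' q'q]].
by exists q' => //; apply/in_invim_principal; exists l.
Qed.

Lemma open_upper_bound (U : open_of T) (l : seq Y) (y : Y) :
  val U l -> upper_bound l y -> val U [:: y].
Proof.
have [down stab] := open_sat U.
suff step m : val U (y :: m) -> upper_bound m y -> val U [:: y].
  by move=> Ul; apply: (step l); apply: down Ul => x; right.
elim: m => // x m IH Uyxm xmy; apply: IH => [|z zm]; last by apply: xmy; right.
have xy : lt x y by apply: xmy; left.
(* The extra copy of [y] is the antecedent of the axiom, with [y :: m] as context; the axiom trades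
   it for [x]. *)
apply: (down _ ((y :: m) ++ [:: y])).
  by move=> z zyy; case: (List.in_app_or (y :: m) [:: y] z zyy) => [//|[<-|//]]; left.
apply: (stab _ _ _ (ideal_axiom_down xy)) => _ ->; apply: down Uyxm => z zyxm.
apply: (List.in_or_app (y :: m) [:: x] z); by case: zyxm => [<-|[<-|zm]]; [left; left|right; left|left; right].
Qed.

(** The bound axiom covers [l] by the singletons of its upper bounds [y]. Each such [y] lies in the
    inverse image of [U], hence in that of [V], and [open_upper_bound] puts [[:: y]] in [V]. *)
Lemma invim_principal_sub (U V : open_of T) :
  invim principal_ideals U `<=` invim principal_ideals V -> (U <= V)%O.
Proof.
move=> UV; apply/open_leP => l Ul; have [_ stab] := open_sat V.
apply: (stab [::] l _ (ideal_axiom_bound lt l)) => _ [y ly <-] /=.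
have /UV /in_invim_principal[m Vm my] : invim principal_ideals U y.
  by apply/in_invim_principal; exists l.
exact: open_upper_bound Vm my.
Qed.

Lemma invim_principal_inj : injective (invim principal_ideals).
Proof.
move=> U V UV; apply/eqP; rewrite Order.POrderTheory.eq_le.
by rewrite !invim_principal_sub // UV.
Qed.

(* As A varies, this is the right adjoint of the inverse image of
   [principal_ideals]. *)
Lemma saturated_upper_bounds (A : set Y) :
  @saturated T [set l | upper_bound l `<=` A].
Proof.
split=> [l m lm mA y ly|k l M ax kM z /upper_bound_cat[kz lz]].
  by apply: mA => x /lm; exact: ly.
case: ax kM lz => {l M} [y' y y'y|l] kM lz.
  apply: (kM [:: y']) => //; apply/upper_bound_cat; split=> //.
  by apply/upper_bound1; case: hY => tr _ _; apply: tr y'y _; apply/upper_bound1.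
(* The interpolant [y] is one of the disjuncts of the bound axiom, and [z] still bounds it together
   with [k]. *)
have [y ly yz] := upper_bound_interpolate lz.
apply: (kM [:: y]); first by exists y.
by apply/upper_bound_cat; split=> //; apply/upper_bound1.
Qed.

Lemma invim_principal_image (A : set Y) :
  (forall q' q, lt q' q -> A q' -> A q) ->
  (forall q, A q -> exists2 q', lt q' q & A q') ->
  exists U, invim principal_ideals U = A.
Proof.
move=> upA rdA; exists (mk_open (saturated_upper_bounds A)).
apply/seteqP; split=> q; first by move/in_invim_principal => [l lA /lA].
(* Roundedness supplies [q']; all its upper bounds lie in [A] because [A] is upper closed. *)
move=> /rdA[q' q'q Aq']; apply/in_invim_principal; exists [:: q'].
  by move=> y /upper_bound1 q'y; exact: upA Aq'.
exact/upper_bound1.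
Qed.

(** * Restriction and extension along the map of principal ideals *)

Lemma comp_principal_monotone (X : space) (g : space_map (RIdl lt) X) :
  monotonicity lt (comp_map g principal_ideals).
Proof. by move=> q' q q'q U; exact: invim_principal_up q'q. Qed.

Lemma below_inhabited (q : Y) : exists q', lt q' q.
Proof. by have [//|q' _ q'q] := @upper_bound_interpolate [::] q; exists q'. Qed.

Lemma below_directed (a b q : Y) :
  lt a q -> lt b q -> exists c, [/\ lt a c, lt b c & lt c q].
Proof.
move=> aq bq; have [_ [<-//|[<-//|//]]|c abc cq] := @upper_bound_interpolate [:: a; b] q.
by exists c; split=> //; apply: abc; [left|right; left].
Qed.

Lemma monotone_below_directed (X : space) (f : space_map (discrete Y) X) (q : Y) :
  monotonicity lt f -> directed [set value f q' | q' in [set q' | lt q' q]].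
Proof.
move=> mono; split; first by have [q' q'q] := below_inhabited q; exists (value f q'), q'.
move=> _ _ [a aq <-] [b bq <-]; have [c [ac bc cq]] := below_directed aq bq.
by exists (value f c); split; [exists c|exact: mono|exact: mono].
Qed.

Lemma comp_principal_continuous (X : space) (g : space_map (RIdl lt) X) :
  continuity lt (comp_map g principal_ideals).
Proof.
move=> q; have mono := @comp_principal_monotone X g; split.
- exact: monotone_below_directed.
- by move=> _ [q' q'q <-]; exact: mono.
(* Since the inverse image of [V] is rounded, some value below [q] already lies in [V], and so does
   every upper bound [z]. *)
move=> z zub V /invim_principal_rounded[q' q'q q'V].
by apply: (zub (value (comp_map g principal_ideals) q')) => //; exists q'.
Qed.

Lemma monotone_continuous_factor (X : space) (f : space_map (discrete Y) X) :
  monotonicity lt f -> continuity lt f ->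
  exists g : space_map (RIdl lt) X, comp_map g principal_ideals = f.
Proof.
move=> mono cont; apply: factor_through_surjection invim_principal_inj _ => V.
apply: invim_principal_image => [q' q /mono/(_ V)//|q Vq].
(* Membership of [value f q] in [V] unfolds to [invim f V q], so continuity of [f] at [q] is what
   makes this set rounded. *)
by have [_ [q' q'q <-] Vq'] := directed_join_open (cont q) (Vq : in_open (value f q) V); exists q'.
Qed.

End PrincipalIdeals.

Theorem lemma1p29 (Y : Type) (lt : Y -> Y -> Prop) (hY : R_structure lt) :
  exists2 phi : space_map (discrete Y) (RIdl lt),
    surjection phi &
    forall X : space,
      set_bij [set: space_map (RIdl lt) X]
        [set f : space_map (discrete Y) X | monotonicity lt f /\ continuity lt f]
        (fun fbar => comp_map fbar phi).
Proof.
have surj := invim_inj_surjection (@invim_principal_inj _ _ hY).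
exists (principal_ideals hY) => [|X]; first exact: surj.
split.
- by move=> g _; split; [exact: comp_principal_monotone|exact: comp_principal_continuous].
(* Uniqueness of the extension is exactly the epimorphism property. *)
- by move=> g h _ _; exact: surj.
- by move=> f [mono cont]; have [g gf] := monotone_continuous_factor hY mono cont; exists g.
Qed.
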